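(* Let $k\ge 1$ be an integer and let $\sigma$ be a probability measure on $\mathbb{R}$ with $\int |x|^k\,d\sigma(x)<\infty$. (1) If $\sigma$ is purely atomic with $m$ atoms and $k\ge 2m$, then the only quadrature formula of degree at least $k$ for $\sigma$ is $\sigma$ itself. Thus, in this case, if $\sigma$ has an atom of irrational weight then $n^0_\sigma(k)=n_\sigma(k)=\infty$, and if all atoms of $\sigma$ have rational weights then $n^0_\sigma(k)<\infty$ and $n_\sigma(k)=\infty$. (2) If $\sigma$ either has a non-atomic component, or it is purely atomic with $m$ atoms and $k<2m$, then $n_\sigma(k)<\infty$. Furthermore, in this case, there exists $n_0\in\mathbb{N}$ such that for every $n\ge n_0$ there exists a Chebyshev-type quadrature formula for $\sigma$ of degree at least $k$ with $n$ nodes, all of which are distinct.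
   Context: For an integer $k\ge1$ and a measure $\sigma$ on $\mathbb{R}$ with finite first $k$ moments, a quadrature formula of degree at least $k$ for $\sigma$ is a set of nodes $\{x_i\}_{i=1}^n\subset\mathbb{R}$ and weights $\{m_i\}_{i=1}^n\subset\mathbb{R}_+$ such that $\int x^j d\sigma(x)=\sum_{i=1}^n m_i x_i^j$ for all integers $0\le j\le k$; it is identified with the atomic measure having mass $m_i$ at $x_i$. For a probability measure $\sigma$, a Chebyshev-type quadrature (formula) of degree at least $k$ with $n$ nodes consists of points $x_1,\dots,x_n\in\mathbb{R}$, not necessarily distinct, with $\int x^j d\sigma(x)=\frac1n\sum_{i=1}^n x_i^j$ for all integers $0\le j\le k$. $n^0_\sigma(k)$ is the minimal number $n$ of nodes required in a Chebyshev-type quadrature for $\sigma$ of degree at least $k$ ($\infty$ if no such quadrature exists). $n_\sigma(k)$ is the minimal integer such that for every $n\ge n_\sigma(k)$ there exists a Chebyshev-type quadrature for $\sigma$ of degree at least $k$ having exactly $n$ nodes ($\infty$ if no such integer exists).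
   Formalization: In part (1), for all atoms of rational weight, the claim that n_σ(k)=∞ is stated only for m≥2 atoms: for m=1, σ is a point mass at a, and repeating the node a gives a Chebyshev-type quadrature for every n≥1, so n_σ(k)=1. *)

(* Defs.v *)
From HB Require Import structures.
From mathcomp Require Import all_boot all_order all_algebra.
From mathcomp Require Import all_classical all_reals all_analysis.

Set Implicit Arguments.
Unset Strict Implicit.
Unset Printing Implicit Defensive.

Import Order.TTheory GRing.Theory Num.Theory.
Import numFieldNormedType.Exports.

Local Open Scope classical_set_scope.
Local Open Scope ring_scope.

Definition atoms (R : realType) (sigma : probability (measurableTypeR R) R) :
    set R :=
  [set x | sigma [set x] != 0%E].

Definition purely_atomic (R : realType)
    (sigma : probability (measurableTypeR R) R) : Prop :=
  sigma (~` atoms sigma) = 0%E.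

(* The non-atomic component of sigma is its restriction to the complement of
   its (countable) set of atoms. *)
Definition has_nonatomic_component (R : realType)
    (sigma : probability (measurableTypeR R) R) : Prop :=
  (0 < sigma (~` atoms sigma))%E.

(* Repeated nodes and zero weights are allowed; neither changes the class of
   measures [atomic_measure x w] that arise. *)
Definition quadrature_formula (R : realType)
    (sigma : probability (measurableTypeR R) R) (k n : nat)
    (x w : 'I_n -> R) : Prop :=
  (forall i, 0 <= w i) /\
  forall j : nat, (j <= k)%N ->
    (\int[sigma]_y (y ^+ j)%:E)%E = (\sum_(i < n) w i * x i ^+ j)%:E.

Definition atomic_measure (R : realType) (n : nat) (x w : 'I_n -> R)
    (A : set R) : \bar R :=
  (\sum_(i < n) (w i)%:E * \d_(x i) A)%E.

(* The case j = 0 excludes n = 0. *)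
Definition chebyshev_type_quadrature (R : realType)
    (sigma : probability (measurableTypeR R) R) (k n : nat)
    (x : 'I_n -> R) : Prop :=
  forall j : nat, (j <= k)%N ->
    (\int[sigma]_y (y ^+ j)%:E)%E = (n%:R^-1 * \sum_(i < n) x i ^+ j)%:E.

(* Infima of sets of natural numbers in the extended reals: they are minima
   when the set is nonempty, and +oo when it is empty. *)
Definition n0_sigma (R : realType)
    (sigma : probability (measurableTypeR R) R) (k : nat) : \bar R :=
  ereal_inf [set n%:R%:E | n in
    [set n : nat | exists x : 'I_n -> R, chebyshev_type_quadrature sigma k x]].

Definition n_sigma (R : realType)
    (sigma : probability (measurableTypeR R) R) (k : nat) : \bar R :=
  ereal_inf [set N%:R%:E | N in
    [set N : nat | forall n : nat, (N <= n)%N ->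
      exists x : 'I_n -> R, chebyshev_type_quadrature sigma k x]].

(* Main.v *)
Require Import Defs.
From HB Require Import structures.
From mathcomp Require Import all_boot all_order all_algebra.
From mathcomp Require Import all_classical all_reals all_analysis.
From mathcomp Require Import measurable_realfun ring lra.
From mathcomp.real_closed Require Import complex.

Set Implicit Arguments.
Unset Strict Implicit.
Unset Printing Implicit Defensive.

Import Order.TTheory GRing.Theory Num.Theory.
Import numFieldNormedType.Exports.

Local Open Scope classical_set_scope.
Local Open Scope ring_scope.

(* Part 1.  If sigma has atoms a_1, ..., a_m and 2m <= k, testing a quadrature formula
   on prod_j (X - a_j)^2 puts its nodes among the a_j, and the Lagrange polynomials at
   the a_j then identify the weights.

   Part 2.  If sigma is not carried by k/2 points, its moment functional L is positive
   on squares of nonzero polynomials of degree at most k/2.  Choosing the even moments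
   beyond k one after the other keeps L positive definite, so L can be taken positive
   definite in degree k - 1; Gauss quadrature for L then has exactly k distinct nodes
   z_i, all with positive weights w_i.  For large n, take about n w_i copies of each z_i:
   the power sums p_1, ..., p_k are off by an amount bounded in n.  The map
   (x_1, ..., x_k) |-> (p_1, ..., p_k) is open at k distinct points, because by Newton's
   identities the power sums determine continuously the coefficients of
   prod_i (X - x_i), whose simple real roots survive a small perturbation.  Hence the
   error can be spread over a number of groups (z_1, ..., z_k) proportional to n.  The
   same openness, applied to k further nodes, allows the repeated nodes to be separated. *)

(** * Gauss quadrature for positive definite moment sequences *)

Lemma lagrange_basis (F : fieldType) (N : nat) (z : 'I_N -> F) :
  injective z -> exists l : 'I_N -> {poly F},
    (forall i, size (l i) <= N)%N /\ forall i j, (l i).[z j] = (i == j)%:R.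
Proof.
move=> zinj; pose q i := \prod_(j < N | j != i) ('X - (z j)%:P).
have qn0 i : (q i).[z i] != 0.
  rewrite horner_prod; apply/prodf_neq0 => j ji.
  by rewrite hornerXsubC subr_eq0 (inj_eq zinj) eq_sym.
exists (fun i => (q i).[z i]^-1 *: q i); split => [i|i j].
  rewrite (leq_trans (size_scale_leq _ _))// size_prod; last first.
    by move=> j _; rewrite polyXsubC_eq0.
  rewrite (eq_bigr (fun=> 2%N)) => [|j _]; last by rewrite size_XsubC.
  rewrite sum_nat_const cardC1 card_ord.
  by case: N i {z zinj q qn0} => [[]//|N _] /=; rewrite muln2 -addnn -addSn addnK.
rewrite hornerZ; have [<-|ij] := eqVneq; first by rewrite mulVf.
by rewrite [X in _ * X]horner_prod (bigD1 j) 1?eq_sym//= hornerXsubC subrr mul0r mulr0.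
Qed.

Lemma poly_eq_at_nodes (F : idomainType) (N : nat) (z : 'I_N -> F) (p : {poly F}) :
  injective z -> (size p <= N)%N -> (forall i, p.[z i] = 0) -> p = 0.
Proof.
move=> zinj sp pz; apply/eqP/negPn/negP => pn0.
have := @max_poly_roots _ p (codom z) pn0.
rewrite map_inj_uniq ?enum_uniq// size_codom card_ord ltnNge sp => /(_ _ isT).
by move=> /(_ _)/notF; apply; apply/allP => _ /codomP[i ->]; rewrite rootE pz.
Qed.

Lemma lagrange_interpolation (F : fieldType) (N : nat) (z : 'I_N -> F)
    (l : 'I_N -> {poly F}) (p : {poly F}) :
  injective z -> (forall i, size (l i) <= N)%N ->
  (forall i j, (l i).[z j] = (i == j)%:R) -> (size p <= N)%N ->
  p = \sum_i p.[z i] *: l i.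
Proof.
move=> zinj sl lz sp; apply/eqP; rewrite -subr_eq0; apply/eqP.
apply: (poly_eq_at_nodes zinj) => [|i].
  rewrite (leq_trans (size_polyD _ _))// geq_max sp size_polyN.
  apply: (leq_trans (size_sum _ _ _)); apply/bigmax_leqP => i _.
  exact: leq_trans (size_scale_leq _ _) (sl i).
rewrite hornerD hornerN horner_sum (bigD1 i)//= big1 => [|j ji].
  by rewrite hornerZ lz eqxx mulr1 addr0 subrr.
by rewrite hornerZ lz (negPf ji) mulr0.
Qed.

Definition moment_functional (R : nzRingType) (s : nat -> R) (p : {poly R}) : R :=
  \sum_(i < size p) p`_i * s i.

Lemma moment_functional_widen (R : nzRingType) (s : nat -> R) (p : {poly R}) N :
  (size p <= N)%N -> moment_functional s p = \sum_(i < N) p`_i * s i.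
Proof.
move=> sp; rewrite /moment_functional (big_ord_widen _ (fun i => p`_i * s i) sp).
rewrite [RHS](bigID (fun i : 'I_N => (i < size p)%N))/= [X in _ = _ + X]big1 ?addr0//.
by move=> i; rewrite -leqNgt => /leq_sizeP/(_ i (leqnn _)) ->; rewrite mul0r.
Qed.

Lemma moment_functional_is_linear (R : nzRingType) (s : nat -> R) :
  linear_for *%R (moment_functional s).
Proof.
move=> a p q; pose N := maxn (size p) (size q).
rewrite !(@moment_functional_widen _ _ _ N) ?leq_maxl ?leq_maxr//; last first.
  rewrite (leq_trans (size_polyD _ _))// geq_max leq_maxr andbT.
  by rewrite (leq_trans (size_scale_leq _ _)) ?leq_maxl.
rewrite mulr_sumr -big_split/=; apply: eq_bigr => i _.
by rewrite coefD coefZ mulrDl mulrA.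
Qed.

HB.instance Definition _ (R : nzRingType) (s : nat -> R) :=
  GRing.isLinear.Build R {poly R} R *%R (moment_functional s)
    (moment_functional_is_linear s).

Lemma moment_functionalXn (R : nzRingType) (s : nat -> R) n :
  moment_functional s 'X^n = s n.
Proof.
rewrite /moment_functional size_polyXn big_ord_recr/= coefXn eqxx mul1r.
by rewrite big1 ?add0r// => i _; rewrite coefXn (ltn_eqF (ltn_ord i)) mul0r.
Qed.

Lemma eq_moment_functional (R : nzRingType) (s t : nat -> R) (p : {poly R}) :
  (forall j, (j < size p)%N -> s j = t j) ->
  moment_functional s p = moment_functional t p.
Proof. by move=> st; apply: eq_bigr => i _; rewrite st. Qed.

(** Positive definiteness of the [d] by [d] Hankel matrix with entries [s (i + j)]. Only [s 0], ...,
    [s (2d - 2)] enter. *)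
Definition posdef_moments (R : realFieldType) (s : nat -> R) (d : nat) : Prop :=
  forall p : {poly R}, p != 0 -> (size p <= d)%N -> 0 < moment_functional s (p * p).

(** Orthogonality to [1], ..., [X^(d-1)] is a linear system for the coefficients of [r], with the
    Hankel matrix [H]. A kernel vector [u] of [H], read as a polynomial, would have L(u * u) = 0, so
    [H] is invertible. *)
Lemma orthogonal_poly (R : realFieldType) (s : nat -> R) (d : nat) :
  posdef_moments s d -> exists r : {poly R}, (size r <= d)%N /\
    forall q : {poly R}, (size q <= d)%N -> moment_functional s (('X^d + r) * q) = 0.
Proof.
move=> pd; pose H := \matrix_(i < d, j < d) s (i + j)%N.
have sr (u : 'rV[R]_d) : (size (rVpoly u) <= d)%N by exact: size_poly.
have LX (p : {poly R}) (j : 'I_d) : (size p <= d)%N ->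
    moment_functional s (p * 'X^j) = (poly_rV p *m H) 0 j.
  move=> sp; rewrite mxE -{1}(poly_rV_K sp) /rVpoly poly_def mulr_suml linear_sum.
  apply: eq_bigr => i _; rewrite insubT//= => id.
  rewrite -scalerAl linearZ/= -exprD moment_functionalXn !mxE/=.
  by congr (_ * _).
have LM (p q : {poly R}) : (size q <= d)%N -> (forall j : 'I_d,
    moment_functional s (p * 'X^j) = 0) -> moment_functional s (p * q) = 0.
  move=> sq p0; rewrite -(poly_rV_K sq) /rVpoly poly_def mulr_sumr linear_sum.
  by rewrite big1// => i _; rewrite -scalerAr linearZ/= p0 mulr0.
have Hu : H \in unitmx.
  rewrite -row_free_unit -kermx_eq0; apply/eqP/row_matrixP => k.
  rewrite row0; apply/eqP/negPn/negP => un0.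
  set u := row k _ in un0; have uH : u *m H = 0 by rewrite /u -row_mul mulmx_ker row0.
  have := pd (rVpoly u); rewrite sr LM ?ltxx ?sr// => [|j]; last first.
    by rewrite LX ?sr// (rVpolyK u) uH mxE.
  move=> /(_ _ isT)/notF; apply; apply: contra un0 => /eqP u0.
  by rewrite -(rVpolyK u) u0 linear0.
pose w : 'rV[R]_d := - \row_j s (d + j)%N.
exists (rVpoly (w *m invmx H)); split; first exact: sr.
move=> q sq; apply: LM => // i; rewrite mulrDl linearD/= (LX (rVpoly _)) ?sr// rVpolyK.
by rewrite mulmxKV// -exprD moment_functionalXn !mxE subrr.
Qed.
(** Let P be the monic orthogonal polynomial of degree [d]. The moment of order [2d] enters L(P * P)
    with coefficient 1, so it can be chosen to give L(P * P) = 1. Writing p = a P + q with deg q <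
    [d], orthogonality yields L(p * p) = a^2 + L(q * q). *)
Lemma posdef_moments_extend1 (R : realFieldType) (s : nat -> R) (d : nat) :
  posdef_moments s d -> exists s' : nat -> R,
    (forall j, (j < d.*2)%N -> s' j = s j) /\ posdef_moments s' d.+1.
Proof.
move=> pd; have [r [sr orth]] := orthogonal_poly pd.
pose P : {poly R} := 'X^d + r.
have sX : size ('X^d : {poly R}) = d.+1 by rewrite size_polyXn.
have sP : size P = d.+1 by rewrite size_polyDl ?sX ?ltnS.
have mP : P \is monic by rewrite monicE lead_coefDl ?sX ?ltnS// lead_coefXn.
pose s' j := if (j < d.*2)%N then s j else s j - moment_functional s (P * P) + 1.
have s'E j : (j < d.*2)%N -> s' j = s j by rewrite /s' => ->.
have LE (p : {poly R}) : (size p <= d.*2)%N -> moment_functional s' p = moment_functional s p.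
  by move=> sp; apply: eq_moment_functional => j jp; rewrite s'E// (leq_trans jp).
have sPP : size (P * P) = d.*2.+1.
  by rewrite size_monicM ?monic_neq0// sP addnS/= addSn addnn.
have LPP : moment_functional s' (P * P) = 1.
  have lPP : (P * P)`_(d.*2) = 1.
    by have /monicP := rpredM mP mP; rewrite /lead_coef sPP.
  rewrite (@moment_functional_widen _ _ _ d.*2.+1) ?sPP// big_ord_recr/=.
  rewrite lPP mul1r {2}/s' ltnn.
  rewrite (@moment_functional_widen _ s _ d.*2.+1) ?sPP// big_ord_recr/= lPP.
  rewrite (eq_bigr (fun i : 'I_(d.*2) => (P * P)`_i * s i)) => [|i _]; last by rewrite s'E.
  by rewrite mul1r; ring.
exists s'; split => // p pn0 sp.
pose a := p`_d; pose q : {poly R} := p - a *: P.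
have sq : (size q <= d)%N.
  apply/leq_sizeP => j; rewrite leq_eqVlt => /predU1P[<-|dj].
    have : P`_d = 1 by have /monicP := mP; rewrite /lead_coef sP.
    by rewrite /q coefB coefZ => ->; rewrite mulr1 subrr.
  rewrite coefB coefZ [p`_j](leq_sizeP _ _ sp)// [P`_j](leq_sizeP P d.+1 _)// ?sP//.
  by rewrite mulr0 subrr.
have pE : p = a *: P + q by rewrite /q addrC subrK.
have -> : p * p = a ^+ 2 *: (P * P) + (a *+ 2) *: (P * q) + q * q.
  by rewrite pE -!mul_polyC rmorphXn/= rmorphMn/=; ring.
rewrite !linearD !linearZ/= LPP mulr1.
have spq : (size (P * q)%R <= d.*2)%N.
  have [->|qn0] := eqVneq q 0; first by rewrite mulr0 size_poly0.
  by rewrite size_monicM// sP addSn/= -addnn leq_add2l.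
rewrite [moment_functional s' (P * q)]LE// orth// mulr0 addr0.
have [q0|qn0] := eqVneq q 0.
  rewrite q0 mulr0 linear0 addr0 exprn_even_gt0//=.
  by apply: contra pn0 => /eqP a0; rewrite pE q0 a0 scale0r addr0.
rewrite ltr_wpDl ?sqr_ge0// LE ?pd//.
rewrite (leq_trans (size_polyMleq _ _))// -addnn.
by rewrite (leq_trans (leq_pred _))// leq_add.
Qed.

Lemma posdef_moments_extend (R : realFieldType) (s : nat -> R) (d e : nat) :
  (d <= e)%N -> posdef_moments s d -> exists s' : nat -> R,
    (forall j, (j < d.*2)%N -> s' j = s j) /\ posdef_moments s' e.
Proof.
move=> /subnK <-; elim: (e - d)%N => [|n IHn] pd; first by exists s.
have [s' [s'E /posdef_moments_extend1[s'' [s''E pd'']]]] := IHn pd.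
exists s''; split => // j jd; rewrite s''E ?s'E// (leq_trans jd)//.
by rewrite leq_double leq_addl.
Qed.

Lemma not_uniq_perm (T : eqType) (s : seq T) :
  ~~ uniq s -> exists x t, perm_eq s [:: x, x & t].
Proof.
elim: s => // y s IHs /=; rewrite negb_and negbK => /orP[ys|/IHs[x [t st]]].
  by exists y, (rem y s); rewrite perm_cons perm_to_rem.
exists x, (y :: t); rewrite (@perm_trans _ (y :: [:: x, x & t])) ?perm_cons//.
by apply/permP => a /=; rewrite addnCA; congr addn; rewrite addnCA.
Qed.

(** The polynomial splits over the complex numbers. A non-real root a + bi would produce the factor
    (X - a)^2 + b^2, and a multiple real root the same factor with b = 0. *)
Lemma split_real_poly (R : rcfType) (P : {poly R}) :
  P \is monic ->
  (forall (Q : {poly R}) a b, P != Q * (('X - a%:P) ^+ 2 + (b ^+ 2)%:P)) ->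
  exists2 z : seq R, uniq z & P = \prod_(x <- z) ('X - x%:P).
Proof.
move=> mP Pirr; pose toC := @real_complex R : {rmorphism R -> complex.complex R}.
have [r Pr] := closed_field_poly_normal (map_poly toC P).
rewrite lead_coef_map (monicP mP) rmorph1 scale1r in Pr.
have rreal : {in r, forall z, complex.Im z = 0}.
  move=> z zr; apply/eqP/negPn/negP => bn0.
  have zP : (map_poly toC P).[z] = 0.
    by apply/eqP; rewrite -/(root _ z) Pr root_prod_XsubC.
  case: z zr bn0 zP => a b zr; move=> bn0 zP.
  pose q : {poly R} := ('X - a%:P) ^+ 2 + (b ^+ 2)%:P.
  have sq : size q = 3%N.
    by rewrite size_polyDl size_exp_XsubC// (leq_ltn_trans (size_polyC_leq1 _)).
  have zq : (map_poly toC q).[Complex a b] = 0.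
    rewrite rmorphD rmorphXn/= rmorphB/= map_polyX !map_polyC/= !hornerE.
    by apply/eqP; rewrite eq_complex/=; apply/andP; split; apply/eqP; ring.
  have sm : (size (P %% q)%R <= 2)%N by rewrite -ltnS -sq ltn_modp -size_poly_eq0 sq.
  have mz : (map_poly toC (P %% q)).[Complex a b] = 0.
    by move: zP; rewrite {1}(divp_eq P q) rmorphD rmorphM/= hornerD hornerM zq mulr0 add0r.
  (* The remainder has degree at most 1 and vanishes at a + bi with b nonzero: the imaginary part
     kills its linear coefficient, then the real part its constant one. *)
  have m0 : P %% q = 0.
    move: mz; rewrite (@horner_coef_wide _ 2); last first.
      by rewrite (leq_trans (size_poly _ _)).
    rewrite !big_ord_recl big_ord0 !coef_map/= expr0 expr1 mulr1 addr0.
    move/eqP; rewrite eq_complex/= => /andP[/eqP e1 /eqP e2].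
    have c1 : (P %% q)`_1 = 0.
      apply/eqP; have /eqP : (P %% q)`_1 * b = 0 by rewrite -[RHS]e2 /bump/=; ring.
      by rewrite mulf_eq0 (negPf (bn0 : b != 0)) orbF.
    have c0 : (P %% q)`_0 = 0 by rewrite -[RHS]e1 /bump/= c1; ring.
    apply/polyP => -[|[|i]]; rewrite coef0 //.
    by rewrite (leq_sizeP _ _ sm).
  by have := Pirr (P %/ q) a b; rewrite -/q {1}(divp_eq P q) m0 addr0 eqxx.
have PE : P = \prod_(x <- map (@complex.Re R) r) ('X - x%:P).
  apply: (map_poly_inj toC); rewrite Pr rmorph_prod/= big_map.
  apply: eq_big_seq => -[a b] /rreal/= ->.
  by rewrite rmorphB/= map_polyX map_polyC.
exists (map (@complex.Re R) r) => //.
apply/negPn/negP => /not_uniq_perm[x [t xt]].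
case/eqP: (Pirr (\prod_(y <- t) ('X - y%:P)) x 0).
by rewrite PE (perm_big _ xt)/= !big_cons expr0n polyC0; ring.
Qed.

(** The nodes are the roots of the orthogonal polynomial P. A factorization P = Q ((X - a)^2 + b^2)
    would give L(P Q) = L(((X - a) Q)^2) + b^2 L(Q^2) > 0, against orthogonality, so the roots are
    real and simple. Exactness follows by division by P: the quotient has degree below [N] and
    contributes nothing, and the remainder is interpolated at the nodes. *)
Lemma gauss_quadrature (R : rcfType) (s : nat -> R) (N : nat) :
  posdef_moments s N -> exists z w : 'I_N -> R,
    [/\ injective z, forall i, 0 < w i &
        forall j, (j < N.*2)%N -> s j = \sum_i w i * z i ^+ j].
Proof.
move=> pd; have [r [sr orth]] := orthogonal_poly pd.
pose P : {poly R} := 'X^N + r.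
have sX : size ('X^N : {poly R}) = N.+1 by rewrite size_polyXn.
have sP : size P = N.+1 by rewrite size_polyDl ?sX ?ltnS.
have mP : P \is monic by rewrite monicE lead_coefDl ?sX ?ltnS// lead_coefXn.
have [Q a b|zs zsU PE] := split_real_poly mP.
  apply/eqP => PE; pose q : {poly R} := ('X - a%:P) ^+ 2 + (b ^+ 2)%:P.
  have Q0 : Q != 0.
    by apply: contraNneq (monic_neq0 mP) => Q0; rewrite PE Q0 mul0r.
  have sQ : (size Q).+2 = N.+1.
    have mq : q \is monic.
      rewrite monicE lead_coefDl ?lead_coef_exp ?lead_coefXsubC ?expr1n//.
      by rewrite size_exp_XsubC (leq_ltn_trans (size_polyC_leq1 _)).
    rewrite -sP PE size_Mmonic// /q size_polyDl size_exp_XsubC ?addn3//.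
    by rewrite (leq_ltn_trans (size_polyC_leq1 _)).
  have := orth Q; rewrite -ltnS -sQ ltnW// => /(_ isT).
  rewrite -/P [in LHS]PE -/q (_ : Q * q * Q =
    ('X - a%:P) * Q * (('X - a%:P) * Q) + b ^+ 2 *: (Q * Q)); last first.
    by rewrite -mul_polyC /q; ring.
  apply/eqP; rewrite linearD linearZ/= gt_eqF// ltr_wpDr//.
    by rewrite mulr_ge0 ?sqr_ge0// ltW// pd// -ltnS -sQ ltnW.
  rewrite pd ?mulf_neq0 ?polyXsubC_eq0//.
  by rewrite size_monicM ?monicXsubC// size_XsubC -ltnS -sQ.
have szs : size zs = N by apply: succn_inj; rewrite -sP PE size_prod_XsubC.
pose z (i : 'I_N) := zs`_i.
have zinj : injective z.
  by move=> i j /eqP; rewrite nth_uniq ?szs// => /eqP/val_inj.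
have Pz i : P.[z i] = 0.
  by apply/eqP; rewrite -/(root _ _) PE root_prod_XsubC mem_nth ?szs.
have [l [sl lz]] := lagrange_basis zinj.
have quad (p : {poly R}) : (size p <= N.*2)%N ->
    moment_functional s p = \sum_i moment_functional s (l i) * p.[z i].
  move=> sp; have sm : (size (p %% P)%R <= N)%N.
    by rewrite -ltnS -sP ltn_modp monic_neq0.
  rewrite {1}(divp_eq p P) linearD/= [_ %/ _ * _]mulrC.
  rewrite orth ?size_divp ?monic_neq0// ?sP ?add0r; last by rewrite leq_subLR addnn.
  rewrite (lagrange_interpolation zinj sl lz sm) linear_sum; apply: eq_bigr => i _.
  rewrite linearZ/= mulrC; congr (_ * _).
  by rewrite {2}(divp_eq p P) hornerD hornerM Pz mulr0 add0r.
exists z, (fun i => moment_functional s (l i)); split => // [i|j jN].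
  have l0 : l i != 0.
    apply: contraTneq (oner_neq0 R) => li0; have := lz i i.
    by rewrite li0 horner0 eqxx => /esym/eqP ->.
  (* Exactness applied to the square of [l i] shows that the weight L(l_i) equals L(l_i^2), hence is
     positive. *)
  have := pd _ l0 (sl i); rewrite [X in 0 < X -> _]quad; last first.
    rewrite (leq_trans (size_polyMleq _ _))// -addnn.
    by rewrite (leq_trans (leq_pred _))// leq_add.
  rewrite (bigD1 i)//= hornerM lz eqxx !mulr1 big1 ?addr0// => k ki.
  by rewrite hornerM lz eq_sym (negPf ki) !mulr0.
rewrite -moment_functionalXn quad ?size_polyXn//.
by apply: eq_bigr => i _; rewrite hornerXn.
Qed.

(** * Newton's identities and perturbation of power sums *)

(** The geometric series in y X is the inverse of 1 - y X; only its terms up to degree [j] affect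
    the coefficient of order [j]. *)
Lemma geometric_coef (R : comNzRingType) (y : R) (g : {poly R}) (j : nat) :
  \sum_(i < j.+1) y ^+ i * ((1 - y *: 'X) * g)`_(j - i) = g`_j.
Proof.
have cE i : ((1 - y *: 'X) * g)`_i = g`_i - y * ('X * g)`_i.
  by rewrite mulrBl mul1r -scalerAl coefB coefZ.
elim: j => [|j IHj].
  by rewrite big_ord_recl big_ord0 cE coefXM/= expr0 mulr0 subr0 mul1r addr0.
rewrite big_ord_recl subn0 cE coefXM/= expr0 mul1r.
under eq_bigr => i _ do rewrite /bump/= exprS -mulrA.
by rewrite -mulr_sumr IHj subrK.
Qed.

(* Coefficientwise form of [- e' / e = \sum_x x / (1 - x X)]. *)
Lemma newton_identity (R : comNzRingType) (s : seq R) (j : nat) :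
  let e := \prod_(x <- s) (1 - x *: 'X) in
  e`_j.+1 *+ j.+1 = - \sum_(i < j.+1) (\sum_(x <- s) x ^+ i.+1) * e`_(j - i).
Proof.
elim: s j => [|y s IHs] j /=.
  rewrite big_nil coef1 mul0rn big1 ?oppr0// => i _.
  by rewrite big_nil mul0r.
rewrite big_cons; set g := \prod_(x <- s) _ in IHs *.
(* With the truncated generating polynomial of the power sums, the induction hypothesis becomes a
   formula for the coefficients of [p * g]. *)
pose p : {poly R} := \poly_(i < j.+1) \sum_(x <- s) x ^+ i.+1.
have pg k : (k <= j)%N ->
    (p * g)`_k = - (g`_k.+1 *+ k.+1).
  move=> kj; rewrite coefM IHs opprK; apply: eq_bigr => i _.
  by rewrite coef_poly (leq_trans (ltn_ord i)).
under eq_bigr => i _ do rewrite big_cons mulrDl exprS -mulrA.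
rewrite big_split/= -mulr_sumr geometric_coef.
have -> : \sum_(i < j.+1) (\sum_(x <- s) x ^+ i.+1) * ((1 - y *: 'X) * g)`_(j - i)
    = (p * ((1 - y *: 'X) * g))`_j.
  by rewrite coefM; apply: eq_bigr => i _; rewrite coef_poly ltn_ord.
have -> : p * ((1 - y *: 'X) * g) = p * g - y *: ('X * (p * g)).
  by rewrite -!mul_polyC; ring.
rewrite coefB coefZ coefXM pg// mulrBl mul1r -scalerAl coefB coefZ coefXM/=.
case: j p pg => [|j] p pg /=; first by rewrite mulr0 subr0 !mulr1n opprD opprK addrC.
rewrite pg// mulrN opprK mulrnBl [y * (_ *+ _)]mulrnAr [_ *+ j.+2 in X in _ - X]mulrS.
by rewrite !opprD !opprK addrCA.
Qed.

(** Substituting 1/X for X and clearing denominators exchanges the two products. Newton's identities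
    concern the second one, the roots the first. *)
Lemma prod_XsubC_coef_rev (R : comNzRingType) (s : seq R) (j : nat) :
  (j <= size s)%N ->
  (\prod_(x <- s) ('X - x%:P))`_(size s - j) = (\prod_(x <- s) (1 - x *: 'X))`_j.
Proof.
elim: s j => [|y s IHs] j /=; first by rewrite leqn0 => /eqP ->; rewrite !big_nil.
have szQ : (size (\prod_(x <- s) (1 - x *: 'X) : {poly R})%R <= (size s).+1)%N.
  elim: s {IHs} => [|x s IHs]; rewrite ?big_nil ?size_poly1// big_cons.
  rewrite (leq_trans (size_polyMleq _ _))//.
  have sx : (size (1 - x *: 'X)%R <= 2)%N.
    rewrite (leq_trans (size_polyD _ _))// geq_max size_poly1 size_polyN.
    by rewrite (leq_trans (size_scale_leq _ _))// size_polyX.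
  by have := leq_add sx IHs; case: (size _ + size _)%N.
rewrite !big_cons mulrBl [in RHS]mulrBl mul1r -scalerAl mul_polyC.
case: j => [_|j]; rewrite !coefB !coefZ !coefXM/=.
  by rewrite -IHs// !subn0 mulr0 [X in _ * X]nth_default ?mulr0 ?size_prod_XsubC.
rewrite ltnS subSS => js; rewrite -(IHs j)//; congr (_ - _).
move: js; rewrite leq_eqVlt => /predU1P[->|js].
  by rewrite subnn/= [RHS]nth_default.
by rewrite -IHs// subn_eq0 leqNgt js/= subnS.
Qed.

(* Lists the coefficients [c_n, ..., c_0] determined by the power sums [p_1, ..., p_n]. *)
Fixpoint newton_seq (F : fieldType) (p : nat -> F) (n : nat) : seq F :=
  if n is n'.+1 then
    let c := newton_seq p n' in
    - (n%:R^-1 * \sum_(i < n) p i.+1 * c`_i) :: c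
  else [:: 1].

Definition newton_coef (F : fieldType) (p : nat -> F) (n : nat) : F :=
  (newton_seq p n)`_0.

Lemma newton_coefS (F : fieldType) (p : nat -> F) (n : nat) :
  newton_coef p n.+1 =
  - (n.+1%:R^-1 * \sum_(i < n.+1) p i.+1 * newton_coef p (n - i)).
Proof.
have nthE m i : (i <= m)%N -> (newton_seq p m)`_i = newton_coef p (m - i).
  elim: m i => [|m IHm] [|i]//; rewrite ltnS => im.
  by rewrite subSS -IHm.
rewrite /newton_coef/= -/(newton_seq p n); congr (- (_ * _)).
by apply: eq_bigr => i _; rewrite nthE// -ltnS.
Qed.

(** In the recursion for the coefficient of order j, [p j] occurs with the nonzero factor -1/j, and
    all other terms involve power sums of lower order. *)
Lemma newton_coef_inj (F : numFieldType) (p q : nat -> F) (N : nat) :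
  (forall j, (j <= N)%N -> newton_coef p j = newton_coef q j) ->
  forall j, (0 < j <= N)%N -> p j = q j.
Proof.
move=> pq j; elim/ltn_ind: j => -[//|j] IHj /= jN.
have := pq _ jN; rewrite !newton_coefS.
have n0 : j.+1%:R^-1 != 0 :> F by rewrite invr_eq0 pnatr_eq0.
move=> /oppr_inj/(mulfI n0); rewrite !big_ord_recr/= subnn /newton_coef/= !mulr1.
rewrite (eq_bigr (fun i : 'I_j => q i.+1 * (newton_seq q (j - i))`_0)) => [/addrI//|i _].
have iN : (i < N)%N := ltn_trans (ltn_ord i) jN.
rewrite (IHj i.+1) ?ltnS//.
by congr (_ * _); apply: pq; rewrite (leq_trans (leq_subr _ _))// ltnW.
Qed.

Lemma newton_coef_psum (F : numFieldType) (s : seq F) (j : nat) :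
  newton_coef (fun i => \sum_(x <- s) x ^+ i) j = (\prod_(x <- s) (1 - x *: 'X))`_j.
Proof.
elim/ltn_ind: j => -[_|j IHj].
  rewrite /newton_coef/= -horner_coef0 horner_prod big1 ?coef1// => x _.
  by rewrite !hornerE ?mulr0 ?subr0.
have n0 : j.+1%:R != 0 :> F by rewrite pnatr_eq0.
rewrite newton_coefS; apply: (mulfI n0); rewrite mulrN mulVKf//.
rewrite mulr_natl newton_identity; congr (- _); apply: eq_bigr => i _.
by rewrite IHj// ltnS leq_subr.
Qed.

Lemma family_lower_bound (R : realFieldType) (I : finType) (P : pred I) (f : I -> R) :
  (forall i, P i -> 0 < f i) -> exists2 g : R, 0 < g & forall i, P i -> g <= f i.
Proof.
(* The default value 1 keeps the minimum positive for an empty family. *)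
move=> f0; exists (\big[Order.min/1]_(i | P i) f i).
  by apply: lt_bigmin => //; exact: ltr01.
by move=> i Pi; exact: bigmin_le_cond.
Qed.

Lemma cvg_sumr (R : realType) (T : Type) (F : set_system T) (FF : Filter F)
    (I : finType) (f : I -> T -> R) (a : I -> R) :
  (forall i, f i t @[t --> F] --> a i) ->
  \sum_i f i t @[t --> F] --> \sum_i a i.
Proof.
by move=> fa; apply: cvg_big => [|i _]; [exact: add_continuous|exact: fa].
Qed.

Lemma cvg_newton_coef (R : realType) (T : Type) (F : set_system T)
    (FF : Filter F) (p : T -> nat -> R) (q : nat -> R) (N : nat) :
  (forall j, (0 < j <= N)%N -> p t j @[t --> F] --> q j) ->
  forall j, (j <= N)%N -> newton_coef (p t) j @[t --> F] --> newton_coef q j.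
Proof.
move=> pq; elim/ltn_ind => -[_ _|j IHj jN]; first exact: cvg_cst.
rewrite newton_coefS; under eq_cvg do rewrite newton_coefS.
apply: cvgN; apply: cvgMl_tmp; apply: cvg_sumr => i.
have iN : (i < N)%N := leq_trans (ltn_ord i) jN.
apply: cvgM; first exact: pq.
apply: IHj; first by rewrite ltnS leq_subr.
by rewrite (leq_trans (leq_subr _ _))// ltnW.
Qed.

(* The roots of a polynomial with simple real roots move continuously with its
   coefficients, which Newton's identities express through the power sums. *)
Lemma power_sums_open (R : realType) (T : Type) (F : set_system T)
    (FF : Filter F) (N : nat) (z : 'I_N -> R) (p : T -> nat -> R) (e : R) :
  injective z -> 0 < e ->
  (forall j, (0 < j <= N)%N -> p t j @[t --> F] --> \sum_i z i ^+ j) ->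
  \forall t \near F, exists z' : 'I_N -> R,
    [/\ injective z', forall i, `|z' i - z i| <= e &
        forall j, (0 < j <= N)%N -> \sum_i z' i ^+ j = p t j].
Proof.
move=> zinj e0 pz.
have [g g0 gz] : exists2 g : R, 0 < g &
    forall ij : 'I_N * 'I_N, ij.1 != ij.2 -> g <= `|z ij.1 - z ij.2|.
  by apply: family_lower_bound => -[i j] ij; rewrite normr_gt0 subr_eq0 (inj_eq zinj).
pose d := Num.min e (g / 3).
have d0 : 0 < d by rewrite lt_min e0 divr_gt0.
have de : d <= e by rewrite ge_min lexx.
have dg : d * 3 <= g by rewrite -ler_pdivlMr// ge_min lexx orbT.
(* The monic polynomial of degree [N] whose roots should have power sums [q]. *)
pose P (q : nat -> R) : {poly R} := \poly_(i < N.+1) newton_coef q (N - i).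
pose zsum j := \sum_i z i ^+ j.
have PE : P zsum = \prod_i ('X - (z i)%:P).
  have -> : zsum = fun j => \sum_(x <- codom z) x ^+ j.
    by apply/funext => j; rewrite /zsum big_image.
  rewrite -(big_image _ _ z xpredT (fun x => 'X - x%:P)).
  have szz : size (codom z) = N by rewrite size_codom card_ord.
  apply/polyP => i; rewrite coef_poly ltnS; case: leqP => iN; last first.
    by rewrite nth_default// size_prod_XsubC szz.
  by rewrite newton_coef_psum -prod_XsubC_coef_rev szz ?leq_subr// subKn.
have Pcvg x : (P (p t)).[x] @[t --> F] --> (P zsum).[x].
  rewrite horner_poly; under eq_cvg do rewrite horner_poly.
  apply: cvg_sumr => i; apply: cvgMr_tmp.
  by apply: cvg_newton_coef pz _ _; rewrite leq_subr.
(* Only the factor X - z_i changes sign between z_i - d and z_i + d, since the other nodes are at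
   distance at least 3d. This sign change persists under small perturbations. *)
have sgn i : (P zsum).[z i - d] * (P zsum).[z i + d] < 0.
  rewrite PE !horner_prod -big_split (bigD1 i)//=.
  rewrite !hornerXsubC nmulr_rlt0; last first.
    by rewrite addrAC subrr sub0r addrAC subrr add0r mulNr oppr_lt0 mulr_gt0.
  apply: prodr_gt0 => j ji; rewrite !hornerXsubC.
  have := gz (i, j); rewrite eq_sym => /(_ ji)/= gij.
  have -> : (z i - d - z j) * (z i + d - z j) = `|z i - z j| ^+ 2 - d ^+ 2.
    by rewrite real_normK ?num_real//; ring.
  rewrite subr_gt0 ltr_pXn2r ?nnegrE ?normr_ge0 ?(ltW d0)//.
  by rewrite (lt_le_trans _ gij)// (lt_le_trans _ dg)//; lra.
have : \forall t \near F, forall i, (P (p t)).[z i - d] * (P (p t)).[z i + d] < 0.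
  apply: filter_forall => i.
  by apply: (cvgr_lt ((P zsum).[z i - d] * (P zsum).[z i + d])) => //; exact: cvgM.
apply: filterS => t Pt.
have /fin_all_exists[z' z'P] : forall i, exists x, `|x - z i| <= d /\ root (P (p t)) x.
  move=> i; have ab : z i - d <= z i + d by lra.
  have := Pt i; case: (ltrP (P (p t)).[z i - d] 0) => [Pa|Pa Pab].
    rewrite nmulr_rlt0// => /ltW Pb.
    have [|x /andP[ax xb] rx] := @poly_ivt _ (P (p t)) _ _ ab; first by rewrite ltW.
    by exists x; split => //; rewrite ler_distl ax.
  have Pb : (P (p t)).[z i + d] <= 0.
    by rewrite leNgt; apply: contraTN Pab => /ltW Pb; rewrite -leNgt mulr_ge0.
  have [|x /andP[ax xb] rx] := @poly_ivt _ (- P (p t)) _ _ ab.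
    by rewrite !hornerN oppr_le0 oppr_ge0 Pa.
  by exists x; rewrite ler_distl ax xb -rootN.
have z'inj : injective z'.
  move=> i j ij; apply/eqP/negPn/negP => /(gz (i, j))/= gij.
  have [+ _] := z'P i; have [+ _] := z'P j; rewrite ij !ler_distl => /andP[a b] /andP[a' b'].
  have : `|z i - z j| <= 2 * d by rewrite ler_norml; apply/andP; split; lra.
  by lra.
exists z'; split => // [i|]; first exact: le_trans (z'P i).1 de.
pose s' := codom z'.
have ss' : size s' = N by rewrite size_codom card_ord.
have lP : (P (p t))`_N = 1 by rewrite coef_poly ltnSn subnn.
have sP : size (P (p t)) = N.+1.
  apply/eqP; rewrite eqn_leq size_poly/= ltnNge; apply/negP => /leq_sizeP/(_ N (leqnn _))/eqP.
  by rewrite lP oner_eq0.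
have PtE : P (p t) = \prod_(x <- s') ('X - x%:P).
  rewrite (@all_roots_prod_XsubC _ (P (p t)) s') ?sP ?ss'//.
  - by rewrite /lead_coef sP lP scale1r.
  - by apply/allP => _ /codomP[i ->]; exact: (z'P i).2.
  - by rewrite uniq_rootsE map_inj_uniq ?enum_uniq.
(* The [N] distinct roots exhaust [P (p t)], so its coefficients are those obtained from the power
   sums of [z']; by injectivity of Newton's recursion these power sums are [p t]. *)
have : forall j, (j <= N)%N -> newton_coef (fun i => \sum_(x <- s') x ^+ i) j = newton_coef (p t) j.
  move=> j jN; rewrite newton_coef_psum -prod_XsubC_coef_rev ?ss'// -PtE coef_poly.
  by rewrite ltnS leq_subr subKn.
move=> /newton_coef_inj h j /h <-.
by rewrite /s' big_image.
Qed.

(** * Chebyshev-type quadratures with many nodes *)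

(* The nodes [y] are spread apart by [t * i], and [z] is moved so as to restore
   the power sums. *)
Lemma distinct_nodes (R : realType) (N n : nat) (z : 'I_N -> R) (y : 'I_n -> R) :
  injective z -> (forall i l, y i != z l) ->
  exists x : 'I_(N + n) -> R, injective x /\
    forall j, (0 < j <= N)%N -> \sum_i x i ^+ j = \sum_i z i ^+ j + \sum_i y i ^+ j.
Proof.
move=> zinj yz.
have [g g0 gyz] : exists2 g : R, 0 < g &
    forall il : 'I_n * 'I_N, xpredT il -> g <= `|y il.1 - z il.2|.
  by apply: family_lower_bound => -[i l] _; rewrite normr_gt0 subr_eq0 yz.
pose Y (t : R) (i : 'I_n) := y i + t * i%:R.
have Yc i : Y t i @[t --> 0^'+] --> y i.
  apply: cvg_at_right_filter.
  suff : Y t i @[t --> (0 : R)] --> y i + 0 * i%:R by rewrite mul0r addr0.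
  by apply: cvgD; [exact: cvg_cst|exact: (@cvgMr_tmp R R (nbhs 0) _ id 0 _ cvg_id)].
(* The power sums required of the moved [z]: they absorb the change caused by spreading [y]. *)
pose p t j := \sum_i z i ^+ j + (\sum_i y i ^+ j - \sum_i Y t i ^+ j).
have pc j : (0 < j <= N)%N -> p t j @[t --> 0^'+] --> \sum_i z i ^+ j.
  move=> _; suff : p t j @[t --> 0^'+] --> \sum_i z i ^+ j + (\sum_i y i ^+ j - \sum_i y i ^+ j).
    by rewrite subrr addr0.
  apply: cvgD; first exact: cvg_cst.
  apply: cvgB; first exact: cvg_cst.
  apply: cvg_sumr => i; apply: (@cvg_comp _ _ _ (Y^~ i) (fun u : R => u ^+ j)).
    exact: Yc.
  exact: exprn_continuous.
have near_z := power_sums_open (at_right_proper_filter 0) zinj (divr_gt0 g0 (ltr0n _ 3)) pc.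
have near_y : \forall t \near 0^'+, forall i, `|y i - Y t i| <= g / 3.
  by apply: filter_forall => i; move/cvgrPdist_le: (Yc i); apply; rewrite divr_gt0.
(* Equal entries of [y] are separated by their indices as soon as t > 0; unequal ones stay apart by
   continuity. *)
have near_inj : \forall t \near 0^'+, forall ij : 'I_n * 'I_n,
    ij.1 != ij.2 -> Y t ij.1 - Y t ij.2 != 0.
  apply: filter_forall => -[i j]/=; have [->|ij] := eqVneq i j.
    by apply: nearW.
  have [yij|yij] := eqVneq (y i) (y j).
    near=> t => _; rewrite /Y yij opprD addrACA subrr add0r -mulrBr.
    apply: mulf_neq0; last by rewrite subr_eq0 eqr_nat.
    by rewrite gt_eqF//; near: t; exact: nbhs_right_gt.
  have : \forall t \near 0^'+, Y t i - Y t j != 0.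
    apply: (cvgr_neq0 (y i - y j)); first by apply: cvgB; exact: Yc.
    by rewrite subr_eq0.
  by apply: filterS.
have [t [[[z' [z'inj z'z z'p]] Yy] Yinj]] :=
  filter_ex (filterI (filterI near_z near_y) near_inj).
have Yz i l : Y t i <> z' l.
  move=> Yz; have := gyz (i, l) isT; have := Yy i; have := z'z l.
  rewrite -Yz /= => /ler_normlP[a b] /ler_normlP[a' b'].
  have : `|y i - z l| <= 2 * (g / 3) by rewrite ler_norml; apply/andP; split; lra.
  by lra.
pose x (k : 'I_(N + n)) := match fintype.split k with inl l => z' l | inr i => Y t i end.
have xl l : x (lshift n l) = z' l by rewrite /x -/(unsplit (inl l)) unsplitK.
have xr i : x (rshift N i) = Y t i by rewrite /x -/(unsplit (inr i)) unsplitK.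
exists x; split.
  move=> a b; case: (split_ordP a) => [l ->|i ->]; case: (split_ordP b) => [l' ->|i' ->].
  - by rewrite !xl => /z'inj ->.
  - by rewrite xl xr => /esym/Yz.
  - by rewrite xl xr => /Yz.
  - rewrite !xr => Yii'; congr rshift; apply/eqP/negPn/negP => /(Yinj (i, i'))/=.
    by rewrite Yii' subrr eqxx.
move=> j jN; rewrite big_split_ord/=.
under eq_bigr do rewrite xl; under [X in _ + X]eq_bigr do rewrite xr.
by rewrite z'p// /p; ring.
Unshelve. all: by end_near. Qed.

Lemma seq_of_multiplicities (R : nzRingType) (I : finType) (b : I -> nat) (z : I -> R) :
  exists s : seq R,
    [/\ size s = (\sum_i b i)%N, {in s, forall x, exists i, x = z i} &
        forall f : R -> R, \sum_(x <- s) f x = \sum_i (b i)%:R * f (z i)].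
Proof.
exists (flatten [seq nseq (b i) (z i) | i <- enum I]); split.
- rewrite size_flatten /shape -map_comp sumnE big_map big_enum/=.
  by apply: eq_bigr => i _; rewrite size_nseq.
- move=> x /flatten_mapP[i _]; rewrite mem_nseq => /andP[_ /eqP ->].
  by exists i.
- move=> f; rewrite big_flatten/= big_map big_enum/=; apply: eq_bigr => i _.
  by rewrite big_nseq mulr_natl; elim: (b i) => [|m /= ->]; rewrite ?mulr0n// mulrS.
Qed.

(* Out of [n] nodes, [k] far away nodes [zeta] are kept in reserve to make all
   nodes distinct, [L] copies of each [z i] are moved to [z' i] to make up for
   the bounded rounding error, and the others stay put. *)
Lemma distinct_chebyshev_nodes (R : realType) (k : nat) (z w : 'I_k -> R) :
  (0 < k)%N -> injective z -> (forall i, 0 < w i) -> \sum_i w i = 1 ->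
  exists n0 : nat, forall n, (n0 <= n)%N -> exists x : 'I_n -> R, injective x /\
    forall j, (0 < j <= k)%N -> \sum_i x i ^+ j = n%:R * \sum_i w i * z i ^+ j.
Proof.
move=> k0 zinj w0 w1.
have [c c0 cw] : exists2 c : R, 0 < c & forall i : 'I_k, xpredT i -> c <= w i.
  by apply: family_lower_bound => i _.
pose i0 := Ordinal k0.
(* Far enough that no point within distance 1 of some [z i] can be a reserve node; 1 is the
   tolerance later allowed for [z']. *)
pose A := 2 + \sum_i `|z i|; pose zeta (l : 'I_k) := A + l%:R.
have zetainj : injective zeta.
  by move=> l l' /addrI/eqP; rewrite eqr_nat => /eqP/val_inj.
have near_zeta x i l : `|x - z i| <= 1 -> x != zeta l.
  move=> xz; apply/eqP => xE; have zA : `|z i| <= \sum_i `|z i|.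
    by rewrite (bigD1 i)//= lerDl sumr_ge0.
  have l0 : 0 <= l%:R :> R by exact: ler0n.
  move: xz; rewrite xE /zeta /A => /ler_normlP[_ +].
  by have := ler_norm (z i); lra.
pose mu j := \sum_i w i * z i ^+ j.
(* Here [m] counts the nodes outside the reserve. A share [c] of each weight is given to the movable
   copies, the share [w i - c] to the fixed ones, and the [r m] nodes lost in rounding down, at most
   2k of them, all go to [z i0]. *)
pose L (m : nat) := Num.truncn (c * m%:R).
pose b (m : nat) i := Num.truncn ((w i - c) * m%:R).
pose r m := (m - (k * L m + \sum_i b m i))%N.
have Lb m : (L m)%:R <= c * m%:R < (L m).+1%:R.
  by apply: truncn_itv; rewrite mulr_ge0// ltW.
have bb m i : (b m i)%:R <= (w i - c) * m%:R < (b m i).+1%:R.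
  by apply: truncn_itv; rewrite mulr_ge0// subr_ge0 cw.
have sumLb m : (k * L m)%:R + \sum_i (b m i)%:R = \sum_i ((L m)%:R + (b m i)%:R) :> R.
  by rewrite big_split/= sumr_const card_ord natrM mulr_natl.
have summ m : m%:R = \sum_i w i * m%:R :> R by rewrite -mulr_suml w1 mul1r.
have rP m : (k * L m + \sum_i b m i <= m)%N.
  rewrite -(ler_nat R) natrD natr_sum sumLb (summ m); apply: ler_sum => i _.
  by have /andP[? _] := Lb m; have /andP[? _] := bb m i; lra.
have rE m : (r m)%:R = \sum_i (w i * m%:R - (L m)%:R - (b m i)%:R) :> R.
  rewrite /r natrB// natrD natr_sum sumLb {1}(summ m) -sumrB.
  by apply: eq_bigr => i _; rewrite opprD addrA.
have dP m i : 0 <= w i * m%:R - (L m)%:R - (b m i)%:R <= 2.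
  by have := Lb m; have := bb m i; rewrite -!natr1; lra.
(* The error in the power sum of order [j] before anything is moved. The terms linear in [m] cancel
   up to rounding, hence the bound [C j] independent of [m]. *)
pose E m j := (m + k)%:R * mu j - \sum_l zeta l ^+ j
  - \sum_i ((L m)%:R + (b m i)%:R) * z i ^+ j - (r m)%:R * z i0 ^+ j.
pose C j := `|k%:R * mu j - \sum_l zeta l ^+ j| + \sum_i 2 * `|z i ^+ j|
  + (\sum_(i < k) 2) * `|z i0 ^+ j|.
have EC m j : `|E m j| <= C j.
  have -> : E m j = (k%:R * mu j - \sum_l zeta l ^+ j)
      + (\sum_i (w i * m%:R - (L m)%:R - (b m i)%:R) * z i ^+ j)
      - (r m)%:R * z i0 ^+ j.
    have -> : \sum_i (w i * m%:R - (L m)%:R - (b m i)%:R) * z i ^+ j =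
        m%:R * mu j - \sum_i ((L m)%:R + (b m i)%:R) * z i ^+ j.
      by rewrite mulr_sumr -sumrB; apply: eq_bigr => i _; ring.
    by rewrite /E natrD; ring.
  rewrite (le_trans (ler_normB _ _))// lerD//.
    rewrite (le_trans (ler_normD _ _))// lerD2l (le_trans (ler_norm_sum _ _ _))//.
    apply: ler_sum => i _; have /andP[d0 d2] := dP m i.
    by rewrite normrM ler_wpM2r// ger0_norm.
  rewrite normrM ger0_norm// ler_wpM2r// rE; apply: ler_sum => i _.
  by have /andP[] := dP m i.
(* Each of the [L m] groups absorbs an equal part of the error, and this part tends to 0. *)
pose p m j := \sum_i z i ^+ j + E m j / (L m)%:R.
have L_large (M : R) : \forall m \near \oo, M < (L m)%:R.
  near=> m; have /andP[_] := Lb m; rewrite -natr1 -ltrBlDr; apply: le_lt_trans.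
  rewrite lerBrDr mulrC -ler_pdivrMr//; near: m; exact: nbhs_infty_ger.
have L_gt0 := L_large 0.
have pc j : (0 < j <= k)%N -> p m j @[m --> \oo] --> \sum_i z i ^+ j.
  move=> _; apply/cvgrPdist_le => e e0; near=> m.
  have Lm0 : 0 < (L m)%:R :> R by near: m.
  rewrite /p opprD addrA subrr sub0r normrN normrM normfV [`|(L m)%:R|]gtr0_norm//.
  rewrite ler_pdivrMr// (le_trans (EC _ _))// mulrC -ler_pdivrMr// ltW//.
  by near: m; exact: L_large.
have [m0 _ m0P] := filterI (power_sums_open _ zinj ltr01 pc) L_gt0.
exists (m0 + k)%N => n n0; have kn : (k <= n)%N := leq_trans (leq_addl _ _) n0.
have /m0P[[z' [z'inj z'z z'p]] Lm0] : (m0 <= n - k)%N by rewrite leq_subRL// addnC.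
set m := (n - k)%N in z'p Lm0.
have [s1 [ss1 s1z s1p]] := seq_of_multiplicities (fun=> L m) z'.
have [s2 [ss2 s2z s2p]] := seq_of_multiplicities (b m) z.
have [s3 [ss3 s3z s3p]] := seq_of_multiplicities (fun=> r m) (fun _ : 'I_1 => z i0).
pose s := s1 ++ s2 ++ s3.
have szs : size s = m.
  rewrite !size_cat ss1 ss2 ss3 sum_nat_const card_ord big_ord1 addnA.
  by rewrite /r subnKC.
have sz i l : tnth (in_tuple s) i != zeta l.
  have := mem_tnth i (in_tuple s); rewrite /= !mem_cat => /or3P[/s1z|/s2z|/s3z] [i' ->].
  - exact: near_zeta (z'z i').
  - by apply: (near_zeta _ i'); rewrite subrr normr0.
  - by apply: (near_zeta _ i0); rewrite subrr normr0.
have [x [xinj xp]] := distinct_nodes zetainj sz.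
have nE : n = (k + size s)%N by rewrite szs subnKC.
have nmu j : n%:R * mu j = (m + k)%:R * mu j by rewrite subnK.
have xq j : (0 < j <= k)%N -> \sum_i x i ^+ j = n%:R * mu j.
  move=> jk; rewrite xp// -(big_tnth _ _ s xpredT (fun u => u ^+ j)) /s !big_cat/=.
  rewrite s1p s2p s3p big_ord1 -mulr_sumr z'p// /p mulrDr mulrC.
  rewrite [_ * (_ / _)]mulrC divfK ?gt_eqF// nmu /E.
  under [X in _ - X - _ * z i0 ^+ j]eq_bigr do rewrite mulrDl.
  by rewrite big_split/= -mulr_sumr; ring.
have : exists y : 'I_(k + size s) -> R, injective y /\
    forall j, (0 < j <= k)%N -> \sum_i y i ^+ j = n%:R * mu j by exists x.
by rewrite -nE.
Unshelve. all: by end_near. Qed.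

(** * Moments of a probability measure *)

Definition moment (R : realType) (sigma : probability (measurableTypeR R) R) (j : nat) : R :=
  fine (\int[sigma]_y (y ^+ j)%:E)%E.

Lemma integrable_pow (R : realType) (sigma : probability (measurableTypeR R) R) (k j : nat) :
  (\int[sigma]_x (`|x| ^+ k)%:E < +oo)%E -> (j <= k)%N ->
  sigma.-integrable setT (fun y => (y ^+ j)%:E).
Proof.
move=> kfin jk; have mX i : measurable_fun setT (fun y : measurableTypeR R => y ^+ i).
  exact: measurable_funX.
have iX : sigma.-integrable setT (fun y => (`|y| ^+ k)%:E).
  apply/integrableP; split.
    by apply/measurable_EFinP; apply: measurable_funX; exact: normr_measurable.
  by under eq_integral => y _ do rewrite gee0_abs ?lee_fin ?exprn_ge0//.
have i1 : sigma.-integrable setT (EFin \o cst 1).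
  exact: finite_measure_integrable_cst.
apply: le_integrable (integrableD measurableT i1 iX) => //.
  by apply/measurable_EFinP; exact: mX.
move=> y _; rewrite /= lee_fin normrX [X in _ <= X]ger0_norm; last first.
  by rewrite addr_ge0 ?exprn_ge0.
have [y1|y1] := leP `|y| 1.
  by rewrite (le_trans (exprn_ile1 _ (normr_ge0 y) y1))// lerDl exprn_ge0.
by rewrite (le_trans (ler_weXn2l (ltW y1) jk))// lerDr.
Qed.

Lemma moment_fin (R : realType) (sigma : probability (measurableTypeR R) R) (k j : nat) :
  (\int[sigma]_x (`|x| ^+ k)%:E < +oo)%E -> (j <= k)%N ->
  (\int[sigma]_y (y ^+ j)%:E)%E = (moment sigma j)%:E.
Proof.
move=> kfin jk; rewrite /moment fineK//; apply: integrable_fin_num => //.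
exact: integrable_pow kfin jk.
Qed.

Lemma integral_horner (R : realType) (sigma : probability (measurableTypeR R) R) (k : nat)
    (p : {poly R}) :
  (\int[sigma]_x (`|x| ^+ k)%:E < +oo)%E -> (size p <= k.+1)%N ->
  (\int[sigma]_y (p.[y])%:E)%E = (moment_functional (moment sigma) p)%:E.
Proof.
move=> kfin sp; rewrite (moment_functional_widen _ sp).
under eq_integral => y _ do rewrite (horner_coef_wide _ sp) -sumEFin.
have iX (i : 'I_k.+1) : sigma.-integrable setT (fun y => (y ^+ i)%:E).
  by apply: integrable_pow kfin _; rewrite -ltnS.
rewrite integral_sum// => [|i]; last first.
  by under eq_fun do rewrite EFinM; exact: integrableZl.
rewrite -sumEFin; apply: eq_bigr => i _; under eq_integral do rewrite EFinM.
by rewrite integralZl// (moment_fin kfin) -?EFinM// -ltnS.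
Qed.

Lemma poly_root_list (R : fieldType) (p : {poly R}) :
  p != 0 -> exists2 s : seq R, (size s < size p)%N & forall x, root p x -> x \in s.
Proof.
elim: (size p) {-2}p (leqnn (size p)) => [|n IHn] {}p sp p0.
  by move: sp; rewrite leqn0 size_poly_eq0 (negPf p0).
have [[x px]|nr] := pselect (exists x, root p x); last first.
  by exists nil => [|x px]; [rewrite size_poly_gt0|case: nr; exists x].
have /factor_theorem[q pE] := px.
have q0 : q != 0 by apply: contraNneq p0 => q0; rewrite pE q0 mul0r.
have sq : size p = (size q).+1 by rewrite pE size_Mmonic ?monicXsubC// size_XsubC addn2.
have [|s ss sP] := IHn q _ q0; first by rewrite -ltnS -sq.
exists (x :: s) => [|y]; first by rewrite sq.
rewrite pE rootM root_XsubC inE => /orP[/sP ->|->]//.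
by rewrite orbT.
Qed.

(** If the integral of p^2 were 0, p would vanish almost everywhere and its roots, at most k/2 in
    number, would carry [sigma]. *)
Lemma posdef_moments_probability (R : realType) (sigma : probability (measurableTypeR R) R)
    (k : nat) :
  (\int[sigma]_x (`|x| ^+ k)%:E < +oo)%E ->
  (forall s : seq R, sigma.-negligible (~` [set` s]) -> (k./2 < size s)%N) ->
  posdef_moments (moment sigma) (k./2).+1.
Proof.
move=> kfin nd p p0 sp.
have spp : (size (p * p)%R <= k.+1)%N.
  rewrite (leq_trans (size_polyMleq _ _))//.
  have : (size p + size p <= (k./2).+1 + (k./2).+1)%N by rewrite leq_add.
  have kk : (k./2.*2 <= k)%N by rewrite -[leqRHS](odd_double_half k) leq_addl.
  rewrite addnS addSn !addnn.
  by case: (size p).*2 => //= n; rewrite ltnS => /leq_trans; apply; rewrite ltnS.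
have pE := integral_horner kfin spp.
have pp0 y : 0 <= (p * p).[y] by rewrite hornerM -expr2 sqr_ge0.
rewrite lt_neqAle; apply/andP; split; last first.
  by rewrite -lee_fin -pE; apply: integral_ge0 => y _; rewrite lee_fin.
apply/eqP => L0; move: pE; rewrite -L0.
under eq_integral => y _ do rewrite -(@gee0_abs _ (p * p).[y]%:E) ?lee_fin//.
have mp : measurable_fun setT (fun y : measurableTypeR R => (p * p).[y]%:E).
  under eq_fun do rewrite horner_coef -sumEFin.
  apply: emeasurable_sum => i; apply/measurable_EFinP.
  by apply: measurable_funM => //; exact: measurable_funX.
move=> /(ae_eq_integral_abs sigma measurableT mp) pae.
have [s ss sP] := poly_root_list p0.
have /nd : sigma.-negligible (~` [set` s]).
  apply: negligibleS pae => y /= ys /(_ I) [] /eqP; rewrite hornerM mulf_eq0 orbb => py.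
  exact/ys/sP.
by rewrite ltnNge -ltnS (leq_trans ss).
Qed.

Lemma negligible_seq (R : realType) (sigma : probability (measurableTypeR R) R) (s : seq R) :
  {in s, forall x, sigma [set x] = 0%E} -> sigma.-negligible [set` s].
Proof.
elim: s => [|x s IHs] s0; first by rewrite set_nil; exact: negligible_set0.
have x0 : sigma.-negligible [set x] by apply/negligibleP; [exact: measurable_set1|exact/s0/mem_head].
have /IHs : {in s, forall x, sigma [set x] = 0%E} by move=> y ys; apply: s0; rewrite inE ys orbT.
move=> /(negligibleU x0); apply: negligibleS => y /=; rewrite inE.
by move=> /predU1P[->|]; [left|right].
Qed.

Lemma card_ordP (T : pointedType) (A : set T) (m : nat) :
  (A #= `I_m)%card -> exists2 a : 'I_m -> T, injective a & A = range a.
Proof.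
rewrite card_eq_sym => /card_set_bijP[f [fA finj fsurj]].
exists (fun i => f i).
  by move=> i j fij; apply/val_inj/finj; rewrite ?inE//=.
apply/seteqP; split => [x /fsurj[i /= im <-]|_ [i _ <-]].
  by exists (Ordinal im).
exact: (fA i (ltn_ord i)).
Qed.

(** A finite list carrying [sigma] contains all atoms, and its other points are null. So there is no
    non-atomic component, the atoms are finite in number, and their number m is at most the length
    of the list. *)
Lemma nondegenerate_support (R : realType) (sigma : probability (measurableTypeR R) R)
    (k : nat) :
  has_nonatomic_component sigma \/
   (purely_atomic sigma /\
    (infinite_set (atoms sigma) \/
     exists2 m : nat, (atoms sigma #= `I_m)%card & (k < 2 * m)%N)) ->
  forall s : seq R, sigma.-negligible (~` [set` s]) -> (k./2 < size s)%N.
Proof.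
move=> H s s0.
have atS : atoms sigma `<=` [set` s].
  move=> x /= x0; apply/negPn/negP => xs; move/eqP: x0; apply.
  apply: measure_negligible => //.
  by apply: negligibleS s0 => _ ->; exact/negP.
have fin_at : finite_set (atoms sigma) by exact: sub_finite_set atS (finite_seq s).
case: H => [na|[_ [//|[m /card_ordP[a ainj aE] km]]]].
  have mat : measurable (~` atoms sigma : set (measurableTypeR R)).
    apply: measurableC; apply: countable_measurable; first exact: measurable_set1.
    exact: finite_set_countable.
  suff : sigma (~` atoms sigma) = 0%E by move=> na0; move: na; rewrite /has_nonatomic_component na0 ltxx.
  apply: measure_negligible => //.
  pose t := [seq x <- s | sigma [set x] == 0%E].
  apply: negligibleS (negligibleU s0 (@negligible_seq _ _ t _)); last first.
    by move=> x; rewrite mem_filter => /andP[/eqP].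
  move=> x /= /negP; rewrite negbK => x0; have [xs|xs] := boolP (x \in s).
    by right; rewrite /= mem_filter x0.
  by left; exact/negP.
rewrite ltn_half_double -mul2n (leq_trans km)// leq_mul2l/=.
have ua : uniq (codom a) by rewrite map_inj_uniq ?enum_uniq.
have -> : m = size (codom a) by rewrite size_codom card_ord.
apply: uniq_leq_size => //.
by move=> _ /codomP[i ->]; apply: atS; rewrite aE; exists i.
Qed.

(** The Gauss rule for the given moments would have k/2 + 1 nodes, possibly fewer than [k].
    Correcting [k] power sums takes [k] nodes, so the moments are first extended to a Hankel matrix
    of size [k]. The extension keeps the moments of order below 2(k/2 + 1), which exceeds [k]. *)
Lemma finite_chebyshev_order (R : realType) (sigma : probability (measurableTypeR R) R)
    (k : nat) :
  (0 < k)%N -> (\int[sigma]_x (`|x| ^+ k)%:E < +oo)%E ->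
  (forall s : seq R, sigma.-negligible (~` [set` s]) -> (k./2 < size s)%N) ->
  exists n0 : nat, forall n : nat, (n0 <= n)%N ->
    exists2 x : 'I_n -> R, injective x & chebyshev_type_quadrature sigma k x.
Proof.
move=> k0 kfin nd; have pd := posdef_moments_probability kfin nd.
have k2 : ((k./2).+1 <= k)%N by rewrite ltn_half_double -addnn -[ltnLHS]addn0 ltn_add2l.
have [s [sE spd]] := posdef_moments_extend k2 pd.
have [z [w [zinj w0 szw]]] := gauss_quadrature spd.
have mE j : (j <= k)%N -> moment sigma j = \sum_i w i * z i ^+ j.
  move=> jk; rewrite -szw; last first.
    by rewrite (leq_ltn_trans jk)// -addnn -[ltnLHS]addn0 ltn_add2l.
  rewrite sE// (leq_ltn_trans jk)// doubleS -[ltnLHS](odd_double_half k).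
  by rewrite -[ltnRHS]add2n ltn_add2r; case: odd.
have w1 : \sum_i w i = 1.
  have := mE 0%N isT; under eq_bigr do rewrite expr0 mulr1; move=> <-.
  apply: EFin_inj; rewrite -(moment_fin kfin)//.
  under eq_integral do rewrite expr0.
  by rewrite -[RHS](@probability_setT _ _ _ sigma) -[RHS]mul1e -integral_cst.
have [n0 n0P] := distinct_chebyshev_nodes k0 zinj w0 w1.
(* At least one node is needed to divide by [n]. *)
exists (maxn 1 n0) => n; rewrite geq_max => /andP[n1 /n0P[x [xinj xp]]].
exists x => // j jk; rewrite (moment_fin kfin)// mE//.
have n_neq0 : n%:R != 0 :> R by rewrite pnatr_eq0 -lt0n.
congr EFin; case: j jk => [_|j jk]; last by rewrite xp// mulKf.
under eq_bigr do rewrite expr0 mulr1; under [in RHS]eq_bigr do rewrite expr0.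
by rewrite w1 sumr_const card_ord mulVf.
Qed.

(** * Measures with finitely many atoms *)

Lemma integral_purely_atomic (R : realType) (sigma : probability (measurableTypeR R) R)
    (m : nat) (a : 'I_m -> R) (f : measurableTypeR R -> R) :
  purely_atomic sigma -> injective a -> atoms sigma = range a -> measurable_fun setT f ->
  (\int[sigma]_y (f y)%:E = (\sum_i fine (sigma [set a i]) * f (a i))%:E)%E.
Proof.
move=> sat ainj aE mf.
(* Off the null set of non-atoms, [f] is a finite combination of indicators of the atoms. *)
have fE : ae_eq sigma setT (EFin \o f)
    (fun y => \sum_i (f (a i))%:E * (\1_[set a i] y)%:E)%E.
  exists (~` atoms sigma); split => //.
    apply: measurableC; apply: countable_measurable; first exact: measurable_set1.
    by rewrite aE; apply: finite_set_countable; exact: finite_image.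
  move=> y /= nE yat; apply: nE => _; move: yat; rewrite aE => -[i _ <-].
  rewrite (bigD1 i)//= indicE mem_set// mule1 big1 ?adde0// => j ji.
  by rewrite indicE memNset ?mule0//= => /ainj/esym/eqP; rewrite (negPf ji).
have i1 i : sigma.-integrable setT (fun y => (f (a i))%:E * (\1_[set a i] y)%:E)%E.
  by apply: integrableZl => //; exact: integrable_indic.
rewrite (@ae_eq_integral _ _ _ sigma setT _ _ measurableT _ _ fE); first last.
- by apply: emeasurable_sum => i; have /integrableP[] := i1 i.
- exact/measurable_EFinP.
rewrite integral_sum// -sumEFin; apply: eq_bigr => i _.
rewrite integralZl//; last exact: integrable_indic.
rewrite integral_indic// setIT muleC EFinM fineK//.
exact: fin_num_measure.
Qed.

(* The polynomial [\prod_j (X - a j)^2], of degree [2 m <= k], forces the nodes [x i]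
   of positive weight to lie among the [a j]. *)
Lemma atomic_moments_unique (R : realFieldType) (k m n : nat)
    (a s : 'I_m -> R) (x w : 'I_n -> R) :
  (2 * m <= k)%N -> injective a -> (forall i, 0 <= w i) ->
  (forall j, (j <= k)%N -> \sum_i w i * x i ^+ j = \sum_i s i * a i ^+ j) ->
  forall f : R -> R, \sum_i w i * f (x i) = \sum_i s i * f (a i).
Proof.
move=> mk ainj w0 wxsa.
have polyE (p : {poly R}) : (size p <= k.+1)%N ->
    \sum_i w i * p.[x i] = \sum_i s i * p.[a i].
  move=> sp; under eq_bigr => i _ do rewrite (horner_coef_wide _ sp) mulr_sumr.
  under [in RHS]eq_bigr => i _ do rewrite (horner_coef_wide _ sp) mulr_sumr.
  rewrite exchange_big [in RHS]exchange_big/=; apply: eq_bigr => j _.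
  under eq_bigr do rewrite mulrCA; under [in RHS]eq_bigr do rewrite mulrCA.
  by rewrite -!mulr_sumr wxsa// -ltnS.
pose q : {poly R} := \prod_j ('X - (a j)%:P); pose p := q * q.
have sq : size q = m.+1.
  by rewrite /q -(big_image _ _ a xpredT (fun c => 'X - c%:P)) size_prod_XsubC size_codom card_ord.
have qa j : q.[a j] = 0.
  by rewrite horner_prod (bigD1 j)//= hornerXsubC subrr mul0r.
have sp : (size p <= k.+1)%N.
  rewrite (leq_trans (size_polyMleq _ _))// sq addnS/= addSn ltnS addnn -mul2n.
  exact: mk.
have p0 : \sum_i w i * p.[x i] = 0.
  by rewrite polyE// big1// => j _; rewrite hornerM qa !mulr0.
have wx i : w i != 0 -> exists j, x i = a j.
  move=> wi; have p_ge0 y : 0 <= p.[y] by rewrite hornerM -expr2 sqr_ge0.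
  have /psumr_eq0P/(_ p0)/(_ i isT)/eqP : forall i, xpredT i -> 0 <= w i * p.[x i].
    by move=> i' _; rewrite mulr_ge0.
  rewrite mulf_eq0 (negPf wi)/= hornerM mulf_eq0 orbb horner_prod.
  by move=> /prodf_eq0[j _]; rewrite hornerXsubC subr_eq0 => /eqP xj; exists j.
have [l [sl la]] := lagrange_basis ainj.
(* Once the nodes of nonzero weight lie among the [a j], the left side is the total weight placed at
   [a j]. *)
have ls j : \sum_i w i * (l j).[x i] = s j.
  have mk1 : (m <= k.+1)%N.
    by rewrite (leq_trans _ (leqnSn k))// (leq_trans _ mk)// leq_pmull.
  rewrite (polyE _ (leq_trans (sl j) mk1)).
  rewrite (bigD1 j)//= la eqxx mulr1 big1 ?addr0// => j' jj'.
  by rewrite la eq_sym (negPf jj') mulr0.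
move=> f; under [in RHS]eq_bigr => j _ do rewrite -ls mulr_suml.
rewrite exchange_big/=; apply: eq_bigr => i _.
have [->|/wx[j ->]] := eqVneq (w i) 0.
  by rewrite mul0r big1// => j _; rewrite !mul0r.
rewrite (bigD1 j)//= la eqxx mulr1 big1 ?addr0// => j' jj'.
by rewrite la (negPf jj') mulr0 mul0r.
Qed.

(** The product of the denominators serves for all; positivity makes the numerators natural
    numbers. *)
Lemma common_denominator (R : realType) (I : finType) (s : I -> R) :
  (forall i, 0 < s i) -> (forall i, rational (s i)) ->
  exists2 d : nat, (0 < d)%N & exists b : I -> nat, forall i, s i = (b i)%:R / d%:R.
Proof.
move=> s0 srat.
have /fin_all_exists[c cP] : forall i, exists c : nat * nat, (0 < c.2)%N /\ s i = c.1%:R / c.2%:R.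
  move=> i; have /rationalP[p [q sE]] := srat i.
  have q0 : (0 < q)%N.
    by rewrite lt0n; apply: contraTneq (s0 i) => q0; rewrite sE q0 invr0 mulr0 ltxx.
  have : 0 <= p%:~R :> R.
    by rewrite -(pmulr_lge0 _ (_ : 0 < q%:R^-1)) -?sE ?ltW// invr_gt0 ltr0n.
  by rewrite ler0z sE; case: p {sE} => // p _; exists (p, q).
exists (\prod_i (c i).2)%N; first by rewrite prodn_gt0// => i; have [] := cP i.
exists (fun i => (c i).1 * \prod_(j | j != i) (c j).2)%N => i.
have -> : (\prod_j (c j).2 = (c i).2 * \prod_(j | j != i) (c j).2)%N.
  by rewrite (bigD1 i).
have [_ ->] := cP i; rewrite !natrM -mulf_div divff ?mulr1//.
rewrite pnatr_eq0 -lt0n prodn_cond_gt0// => j _; by have [] := cP j.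
Qed.

Lemma chebyshev_quadrature_formula (R : realType)
    (sigma : probability (measurableTypeR R) R) (k n : nat) (x : 'I_n -> R) :
  chebyshev_type_quadrature sigma k x ->
  quadrature_formula sigma k x (fun=> n%:R^-1).
Proof.
move=> xP; split => [i|j jk]; first by rewrite invr_ge0.
by rewrite xP// mulr_sumr.
Qed.

Theorem theorem1p1 (R : realType) (k : nat)
    (sigma : probability (measurableTypeR R) R) :
  (1 <= k)%N ->
  (\int[sigma]_x (`|x| ^+ k)%:E < +oo)%E ->
  (forall m : nat, purely_atomic sigma -> (atoms sigma #= `I_m)%card ->
    (2 * m <= k)%N ->
    [/\ (forall (n : nat) (x w : 'I_n -> R), quadrature_formula sigma k x w ->
           forall A : set (measurableTypeR R), measurable A ->
             atomic_measure x w A = sigma A),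
        (exists (n : nat) (x w : 'I_n -> R), quadrature_formula sigma k x w /\
           forall A : set (measurableTypeR R), measurable A ->
             atomic_measure x w A = sigma A),
        ((exists2 x, atoms sigma x & irrational (fine (sigma [set x]))) ->
           n0_sigma sigma k = +oo%E /\ n_sigma sigma k = +oo%E) &
        ((forall x, atoms sigma x -> rational (fine (sigma [set x]))) ->
           (n0_sigma sigma k < +oo)%E /\
           ((1 < m)%N -> n_sigma sigma k = +oo%E))])
  /\
  (has_nonatomic_component sigma \/
   (purely_atomic sigma /\
    (infinite_set (atoms sigma) \/
     exists2 m : nat, (atoms sigma #= `I_m)%card & (k < 2 * m)%N)) ->
   (n_sigma sigma k < +oo)%E /\
   exists n0 : nat, forall n : nat, (n0 <= n)%N ->
     exists2 x : 'I_n -> R, injective x & chebyshev_type_quadrature sigma k x).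
Proof.
move=> k0 kfin; split; last first.
  move=> /nondegenerate_support nd.
  have [n0 n0P] := finite_chebyshev_order k0 kfin nd; split; last by exists n0.
  apply: (@le_lt_trans _ _ n0%:R%:E); last exact: ltry.
  apply: ereal_inf_lbound; exists n0 => // n /n0P[x _ xP].
  by exists x.
move=> m sat /card_ordP[a ainj aE] mk.
pose s i := fine (sigma [set a i]).
have sfin (B : set (measurableTypeR R)) : measurable B -> sigma B \is a fin_num.
  exact: fin_num_measure.
have sE i : sigma [set a i] = (s i)%:E by rewrite fineK// sfin.
have s0 i : 0 < s i.
  have /eqP ai : atoms sigma (a i) by rewrite aE; exists i.
  by rewrite lt_neqAle -lee_fin -sE measure_ge0 andbT eq_sym; apply/eqP => si; apply: ai; rewrite sE si.
have intE := integral_purely_atomic sat ainj aE.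
have momE j : (\int[sigma]_y (y ^+ j)%:E = (\sum_i s i * a i ^+ j)%:E)%E.
  by rewrite intE//; exact: measurable_funX.
have sigmaE (A : set (measurableTypeR R)) : measurable A ->
    sigma A = (\sum_i s i * \1_A (a i))%:E.
  move=> mA; rewrite -(intE (\1_A)); last exact: measurable_indic.
  by rewrite integral_indic// setIT.
have s1 : \sum_i s i = 1.
  apply: EFin_inj; rewrite -(@probability_setT _ _ _ sigma) sigmaE//.
  by under [in RHS]eq_bigr do rewrite indicT mulr1.
have am (n : nat) (x w : 'I_n -> R) A : atomic_measure x w A = (\sum_i w i * \1_A (x i))%:E.
  by rewrite /atomic_measure -sumEFin; apply: eq_bigr => i _; rewrite diracE indicE EFinM.
have uniqueness (n : nat) (x w : 'I_n -> R) : quadrature_formula sigma k x w ->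
    forall A : set (measurableTypeR R), measurable A -> atomic_measure x w A = sigma A.
  move=> [w0 wm] A mA; rewrite am sigmaE//; congr EFin.
  apply: (atomic_moments_unique mk ainj w0) => j jk.
  by apply: EFin_inj; rewrite -wm.
(* Uniqueness, evaluated on singletons, makes each atom's weight a count of nodes divided by [n],
   hence rational. *)
have chebyshev_atoms (n : nat) (x : 'I_n -> R) : chebyshev_type_quadrature sigma k x ->
    forall i, s i = #|[pred j | x j == a i]|%:R / n%:R.
  move=> /chebyshev_quadrature_formula/uniqueness/(_ _ (measurable_set1 (a _))) xs i.
  apply: EFin_inj; rewrite -sE -xs am -mulr_sumr mulrC; congr (_ * _)%:E.
  rewrite -sum1_card natr_sum [RHS]big_mkcond; apply: eq_bigr => j _.
  rewrite indicE inE/=; case: eqP => xa; first by rewrite mem_set.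
  by rewrite memNset.
split.
- exact: uniqueness.
- exists m, a, s; split.
    split => [i|j _]; [exact: ltW|exact: momE].
  by move=> A mA; rewrite am sigmaE.
- move=> [x0]; rewrite aE => -[i _ <-] irr.
  have none n (x : 'I_n -> R) : ~ chebyshev_type_quadrature sigma k x.
    move=> /chebyshev_atoms/(_ i) sr; apply: irr; rewrite -/(s i) sr.
    by apply/rationalP; exists #|[pred j | x j == a i]|%:Z, n.
  split; rewrite -(@ereal_inf0 R); congr ereal_inf; rewrite -subset0 => z [n nP _].
    by case: nP => x /none.
  by have [x /none] := nP n (leqnn n).
move=> srat.
have [|d d0 [b bE]] := common_denominator s0.
  by move=> i; apply: srat; rewrite aE; exists i.
have sumb : (\sum_i b i)%N = d.
  apply/eqP; rewrite -(eqr_nat R) natr_sum.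
  have dn0 : d%:R != 0 :> R by rewrite pnatr_eq0 -lt0n.
  rewrite -(inj_eq (mulIf (invr_neq0 dn0))) divff// mulr_suml.
  by apply/eqP; rewrite -[RHS]s1; apply: eq_bigr => i _; rewrite bE.
split.
  (* With weights b_i / d, repeating each [a i] exactly [b i] times gives a quadrature with [d]
     nodes. *)
  have [t [st _ tp]] := seq_of_multiplicities b a.
  apply: (@le_lt_trans _ _ (size t)%:R%:E); last exact: ltry.
  apply: ereal_inf_lbound; exists (size t) => //; exists (tnth (in_tuple t)) => j jk.
  rewrite momE -(big_tnth _ _ t xpredT (fun u => u ^+ j)) tp st sumb mulr_sumr.
  by congr EFin; apply: eq_bigr => i _; rewrite bE mulrAC mulrC mulrA.
(* With two atoms or more, some weight s satisfies 0 < s < 1. Quadratures with M and M + 1 nodes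
   would make both s M and s (M + 1) integers, though they differ by s. *)
move=> m1; rewrite -(@ereal_inf0 R); congr ereal_inf; rewrite -subset0 => z [N NP _].
pose i0 := Ordinal (ltnW m1); pose i1 := Ordinal m1.
have si0 : s i0 < 1.
  rewrite -s1 (bigD1 i0)//= ltrDl (bigD1 i1)//= ltr_wpDr//.
  by apply: sumr_ge0 => i _; exact: ltW.
pose M := maxn N 1.
have [x /chebyshev_atoms/(_ i0) xs] := NP M (leq_maxl _ _).
have [y /chebyshev_atoms/(_ i0) ys] := NP M.+1 (leq_trans (leq_maxl _ _) (leqnSn M)).
move: xs ys; set c := #|_|; set c' := #|_| => xs ys.
have M0 : (0 < M)%N by rewrite leq_max orbT.
have cM : c%:R = s i0 * M%:R :> R by rewrite xs divfK// pnatr_eq0 -lt0n.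
have c'M : c'%:R = s i0 * M.+1%:R :> R by rewrite ys divfK// pnatr_eq0.
have c_lt : (c < c')%N by rewrite -(ltr_nat R) cM c'M ltr_pM2l// ltr_nat.
have c'_lt : (c' < c.+1)%N.
  by rewrite -(ltr_nat R) -natr1 cM c'M -natr1 mulrDr ltrD2l mulr1.
by move: c'_lt; rewrite ltnS leqNgt c_lt.
Qed.
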